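(* Let $G$ be a diffeological group with identity $e$. Then $T^H(G)$ is a diffeological vector space over $G$, and $T^H(G)$, $G\times T_e^H(G)$, $T^{dvs}(G)$ and $G\times T_e^{dvs}(G)$ are all isomorphic as diffeological vector spaces over $G$. Therefore $T_g^H(G)=T_g^{dvs}(G)$ for every $g\in G$.
   Context: A diffeological space is a set with, for every open subset $U$ of every $\mathbb{R}^n$, a set of maps $U\to X$ called plots, containing constants, closed under precomposition with smooth maps, and satisfying the sheaf condition; smooth maps send plots to plots. A diffeological group is a group with a diffeology for which multiplication and inversion are smooth. The internal tangent space $T_x(X)$ is the colimit in real vector spaces, over the category of plots $p:U\to X$ with $U$ a connected open neighbourhood of $0$ in some $\mathbb{R}^n$ and $p(0)=x$ (morphisms: smooth $f:U\to V$ with $f(0)=0$ and $q\circ f=p$), of $p\mapsto T_0(U)$, $f\mapsto f_*$. The internal tangent bundle is $TX=\coprod_x T_x(X)$. For a plot $f:U\to X$ with $U$ connected, $Tf:TU\to TX$ sends $T_u(U)$ to $T_{f(u)}(X)$ via $T_u(U)\cong T_0(U-u)\to T_{f(u)}(X)$ induced by $w\mapsto f(w+u)$. Hector's diffeology on $TX$ is generated by all such $Tf$; $T^H(X)$ denotes $TX$ with it. A diffeological vector space over $X$ is a diffeological space $V$ with a smooth map $V\to X$ and vector space structures on fibres such that fibrewise addition $V\times_XV\to V$, scalar multiplication $\mathbb{R}\times V\to V$ and the zero section are smooth. The dvs diffeology is the smallest diffeology on $TX$ containing Hector's diffeology that makes $TX\to X$ a diffeological vector space over $X$; $T^{dvs}(X)$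 denotes $TX$ with it. $T_x^H(X)$ and $T_x^{dvs}(X)$ denote $T_x(X)$ with the corresponding sub-diffeologies; $G\times T_e^H(G)$ etc. are regarded over $G$ via the first projection. *)

(* Defs.v *)
From HB Require Import structures.
From mathcomp Require Import all_boot all_order all_algebra.
From mathcomp Require Import all_classical all_reals all_analysis.
From mathcomp Require Import Rstruct Rstruct_topology.
Set Implicit Arguments. Unset Strict Implicit. Unset Printing Implicit Defensive.
Import Order.TTheory GRing.Theory Num.Theory.
Import numFieldNormedType.Exports.
Local Open Scope classical_set_scope.
Local Open Scope ring_scope.

Notation RR := Rdefinitions.R.
Notation E n := 'rV[RR]_n.

Fixpoint Ck (k n m : nat) (U : set (E n)) (f : E n -> E m) {struct k} : Prop :=
  match k with
  | 0 => forall x, U x -> {for x, continuous f}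
  | k'.+1 => (forall x, U x -> differentiable f x) /\
             forall v : E n, Ck k' U (fun x => 'D_v f x)
  end.

Definition smooth n m (U : set (E n)) (f : E n -> E m) : Prop :=
  forall k, Ck k U f.

(* A "parametrization" with domain U (open subset of R^n) is represented by a
   total map E n -> X of which only the values on U matter. *)
Definition plots (X : Type) := forall n : nat, set (E n) -> (E n -> X) -> Prop.

Definition is_diffeology (X : Type) (P : plots X) : Prop :=
  (forall n U p, P n U p -> open U) /\
  (* plots are maps U -> X: only values on U matter *)
  (forall n U p q, P n U p -> (forall u, U u -> p u = q u) -> P n U q) /\
  (forall n U (x : X), open U -> P n U (fun _ => x)) /\
  (forall n m (U : set (E n)) (V : set (E m)) p f, open U -> P m V p ->
      smooth U f -> (forall u, U u -> V (f u)) -> P n U (p \o f)) /\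
  (forall n U p, open U ->
      (forall u, U u -> exists W : set (E n), [/\ open W, W u, W `<=` U & P n W p]) ->
      P n U p).

Definition smooth_map (X Y : Type) (P : plots X) (Q : plots Y) (f : X -> Y) : Prop :=
  forall n U p, P n U p -> Q n U (f \o p).

Definition prod_plots (X Y : Type) (P : plots X) (Q : plots Y) : plots (X * Y) :=
  fun n U p => P n U (fst \o p) /\ Q n U (snd \o p).

Arguments prod_plots {X Y} P Q _ _ _.

Definition induced_plots (A X : Type) (i : A -> X) (P : plots X) : plots A :=
  fun n U p => P n U (i \o p).

Arguments induced_plots {A X} i P _ _ _.

Definition R_plots : plots RR :=
  fun n U p => open U /\ smooth U (fun u => const_mx (p u) : E 1).

Arguments R_plots _ _ _.

Definition is_diffeological_group (G : Type) (P : plots G)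
  (mul : G -> G -> G) (inv : G -> G) (e : G) : Prop :=
  is_diffeology P /\
  [/\ (forall a b c, mul a (mul b c) = mul (mul a b) c),
      (forall a, mul e a = a /\ mul a e = a),
      (forall a, mul (inv a) a = e /\ mul a (inv a) = e),
      smooth_map (prod_plots P P) P (fun ab => mul ab.1 ab.2)
    & smooth_map P P inv].

Section Tangent.
Variables (X : Type) (P : plots X).

(* objects of the category of plots centred at x *)
Definition pointed (x : X) n (U : set (E n)) (p : E n -> X) : Prop :=
  [/\ @P n U p, connected U, U 0 & p 0 = x].

Definition plot_mor n m (U : set (E n)) (V : set (E m)) (p : E n -> X)
  (q : E m -> X) (f : E n -> E m) : Prop :=
  [/\ smooth U f, (forall u, U u -> V (f u)), f 0 = 0
    & (forall u, U u -> q (f u) = p u)].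

Definition lin (V W : lmodType RR) (h : V -> W) : Prop :=
  forall (a : RR) u v, h (a *: u + v) = a *: h u + h v.

(* a cocone under the functor (n,U,p) |-> T_0(U) = R^n, f |-> f_* = d f(0) *)
Definition cocone (x : X) (W : lmodType RR)
  (phi : forall n, set (E n) -> (E n -> X) -> E n -> W) : Prop :=
  (forall n U p, pointed x U p -> lin (phi n U p)) /\
  (forall n m U V p q f, @pointed x n U p -> @pointed x m V q ->
      plot_mor U V p q f -> forall v, phi m V q ('d f 0 v) = phi n U p v).

Definition is_tangent_colimit (x : X) (Tx : lmodType RR)
  (iota : forall n, set (E n) -> (E n -> X) -> E n -> Tx) : Prop :=
  cocone x iota /\
  forall (W : lmodType RR) (phi : forall n, set (E n) -> (E n -> X) -> E n -> W),
    cocone x phi ->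
    exists h : Tx -> W,
      [/\ lin h,
          (forall n U p, pointed x U p -> forall v, h (iota n U p v) = phi n U p v)
        & forall h' : Tx -> W, lin h' ->
            (forall n U p, pointed x U p -> forall v, h' (iota n U p v) = phi n U p v) ->
            forall t, h' t = h t].

Variables (T : X -> lmodType RR)
  (iota : forall x n, set (E n) -> (E n -> X) -> E n -> T x).

(* TU = U x R^n, seen as an open subset of R^(n+n) *)
Definition tset n (U : set (E n)) : set (E (n + n)) :=
  [set w | U (lsubmx w)].

(* Tf : TU -> TX, (u,v) |-> image of v under T_0(U-u) -> T_{f(u)}(X)
   induced by the plot w |-> f(w+u) *)
Definition tmap n (U : set (E n)) (f : E n -> X) (w : E (n + n)) : {x : X & T x} :=
  existT (fun x => T x) (f (lsubmx w))
    (iota (f (lsubmx w)) [set y | U (y + lsubmx w)] (fun y => f (y + lsubmx w))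
          (rsubmx w)).

Definition hector_plots : plots {x : X & T x} :=
  fun m W p => forall Q : plots {x : X & T x}, is_diffeology Q ->
    (forall n U f, @P n U f -> connected U -> Q (n + n)%N (tset U) (tmap U f)) ->
    Q m W p.

End Tangent.

Arguments hector_plots {X} P {T} iota _ _ _.

Section DVS.
Variables (X : Type) (F : X -> lmodType RR).

Definition fib_pairs := {ab : {x : X & F x} * {x : X & F x} | projT1 ab.1 = projT1 ab.2}.

Definition fib_add (s : fib_pairs) : {x : X & F x} :=
  existT (fun x => F x) (projT1 (sval s).1)
    (projT2 (sval s).1 +
       eq_rect _ (fun x => F x : Type) (projT2 (sval s).2) _ (esym (svalP s))).

Definition fib_scale (rv : RR * {x : X & F x}) : {x : X & F x} :=
  existT (fun x => F x) (projT1 rv.2) (rv.1 *: projT2 rv.2).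

Definition zero_sec (x : X) : {x : X & F x} := existT (fun x => F x) x 0.

Definition is_dvs (P : plots X) (Q : plots {x : X & F x}) : Prop :=
  [/\ smooth_map Q P (@projT1 X (fun x => F x)),
      smooth_map (induced_plots (@sval _ _ : fib_pairs -> _) (prod_plots Q Q)) Q fib_add,
      smooth_map (prod_plots R_plots Q) Q fib_scale
    & smooth_map P Q zero_sec].

End DVS.

Definition tot (X : Type) (F1 F2 : X -> lmodType RR) (h : forall x, F1 x -> F2 x)
  (s : {x : X & F1 x}) : {x : X & F2 x} :=
  existT (fun x => F2 x) (projT1 s) (h (projT1 s) (projT2 s)).

Definition dvs_iso (X : Type) (F1 F2 : X -> lmodType RR)
  (Q1 : plots {x : X & F1 x}) (Q2 : plots {x : X & F2 x}) : Prop :=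
  exists (h : forall x, F1 x -> F2 x) (k : forall x, F2 x -> F1 x),
    [/\ forall x, lin (h x) /\ lin (k x),
        forall x, cancel (h x) (k x),
        forall x, cancel (k x) (h x),
        smooth_map Q1 Q2 (tot h)
      & smooth_map Q2 Q1 (tot k)].

Definition dvs_plots (X : Type) (P : plots X) (T : X -> lmodType RR)
  (iota : forall x n, set (E n) -> (E n -> X) -> E n -> T x) : plots {x : X & T x} :=
  fun m W p => forall Q : plots {x : X & T x}, is_diffeology Q ->
    (forall n U q, hector_plots P iota n U q -> Q n U q) ->
    is_dvs P Q -> Q m W p.

Arguments dvs_plots {X} P {T} iota _ _ _.

(* the product X x V (V a fibre, with diffeology Qv) as a space over X *)
Definition prodc_plots (X : Type) (V : lmodType RR) (P : plots X) (Qv : plots V) :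
  plots {x : X & V} :=
  fun n U p => P n U (fun u => projT1 (p u)) /\ Qv n U (fun u => projT2 (p u)).

Arguments prodc_plots {X V} P Qv _ _ _.

Definition fibre_plots (X : Type) (T : X -> lmodType RR) (x : X)
  (Q : plots {x : X & T x}) : plots (T x) :=
  induced_plots (existT (fun x => T x) x) Q.
Arguments fibre_plots {X T} x Q _ _ _.

(* Main.v *)
Require Import Defs.
From HB Require Import structures.
From mathcomp Require Import all_boot all_order all_algebra.
From mathcomp Require Import all_classical all_reals all_analysis.
From mathcomp Require Import Rstruct Rstruct_topology.
Set Implicit Arguments. Unset Strict Implicit. Unset Printing Implicit Defensive.
Import Order.TTheory GRing.Theory Num.Theory.
Import numFieldNormedType.Exports.
Local Open Scope classical_set_scope.
Local Open Scope ring_scope.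

(* Near each point, a plot of Hector's diffeology has the form
   w |-> Tf (a w, b w) for a plot f of G and smooth a, b.  Two such plots Tf and
   Tg lying over the same curve in G are added by means of the single plot
   (x, y, y') |-> f x (g y)^-1 g y': at a point (x, y, y) with f x = g y, the
   direction (v, 0, v') is sent to f_* v + g_* v'.  The same formula shows that
   every tangent vector is the velocity of one plot.  Hence Hector's diffeology
   is already a vector space diffeology, so it coincides with the dvs one, and
   left translations, through the plots (x, y) |-> (f x)^-1 f y and
   (w, x) |-> q w * f x, trivialize the bundle. *)

(** * Smooth maps between Euclidean spaces *)

(** The first-order expansion of [f] at [a] is also one of [g], since the two maps agree near [a]
    and hence at [a]; [diff_unique] then identifies the two differentials. *)
Lemma near_eq_differentiable (K : numFieldType) (V W : normedModType K)
    (f g : V -> W) (a : V) :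
  (\forall x \near a, f x = g x) -> differentiable f a -> differentiable g a.
Proof.
move=> fg df; have [dfc dfo] := (diff_locallyP a f).1 df.
have go : g \o shift a = cst (g a) + 'd f a +o_ 0 id.
  apply/eqaddoP => eps eps0; have /eqaddoP/(_ _ eps0) fo := dfo.
  have fg0 : \forall h \near (0 : V), f (h + a) = g (h + a).
    by move: fg; rewrite (near_shift 0) /=; apply: filterS => h; rewrite subr0.
  near=> h; have foh : `|(f (h + a) - (f a + 'd f a h))| <= eps * `|h|.
    by near: h; exact: fo.
  have -> : (g \o shift a - (cst (g a) + 'd f a)) h =
    f (h + a) - (f a + 'd f a h); last exact: foh.
  by rewrite (nbhs_singleton fg) (near fg0 h).
apply/diff_locallyP; rewrite (diff_unique dfc go); split => //.
Unshelve. all: by end_near. Qed.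

(** Maps are total but only their values on [U] count. As [U] is open, agreement on [U] is agreement
    near each of its points, so the derivatives agree on [U] too and the induction continues. *)
Lemma Ck_congr k n m (U : set (E n)) (f g : E n -> E m) :
  open U -> (forall x, U x -> f x = g x) -> Ck k U f -> Ck k U g.
Proof.
move=> oU; elim: k f g => [|k IH] f g fg /=.
  move=> cf x Ux; have fgx : \forall y \near x, f y = g y.
    by apply: filterS (open_nbhs_nbhs (conj oU Ux)) => y /fg.
  change (g @ x --> g x); rewrite -(fg _ Ux).
  by apply: cvg_trans (cf _ Ux); exact: (@near_eq_cvg _ _ (nbhs x) _ f g).
have fgn x : U x -> \forall y \near x, f y = g y.
  by move=> Ux; apply: filterS (open_nbhs_nbhs (conj oU Ux)) => y /fg.
move=> [df Df]; split => [x Ux|v].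
  exact: near_eq_differentiable (fgn _ Ux) (df _ Ux).
by apply: IH (Df v) => x Ux; apply: near_eq_derive; exact: fgn.
Qed.

Lemma CkW k n m (U : set (E n)) (f : E n -> E m) : Ck k.+1 U f -> Ck k U f.
Proof.
elim: k f => [|k IH] f [df Df]; first by move=> x /df /differentiable_continuous.
by split => // v; exact (IH _ (Df v)).
Qed.

Lemma Ck_cst k n m (U : set (E n)) (c : E m) : Ck k U (fun _ => c).
Proof.
elim: k c => [|k IH] c /=; first by move=> x _; exact: cst_continuous.
split=> [x _|v]; first exact: differentiable_cst.
have -> : 'D_v (fun _ : E n => c) = (fun=> 0) by apply/funext => x; rewrite derive_cst.
exact: IH.
Qed.

Lemma CkD k n m (U : set (E n)) (f g : E n -> E m) :
  open U -> Ck k U f -> Ck k U g -> Ck k U (fun x => f x + g x).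
Proof.
move=> oU; elim: k f g => [|k IH] f g.
  by move=> cf cg x Ux; apply: continuousD; [exact: cf|exact: cg].
move=> [df Df] [dg Dg]; split=> [x Ux|v].
  by apply: (@differentiableD _ _ _ f g); [exact: df|exact: dg].
apply: Ck_congr (IH _ _ (Df v) (Dg v)) => // x Ux; apply/esym.
by apply: (@deriveD _ _ _ f g); apply: diff_derivable; [exact: df|exact: dg].
Qed.

Lemma Ck_sum k n m p (U : set (E n)) (f : 'I_p -> E n -> E m) :
  open U -> (forall i, Ck k U (f i)) -> Ck k U (fun x => \sum_i f i x).
Proof.
move=> oU; elim: p f => [|p IH] f cf.
  by under eq_fun do rewrite big_ord0; exact: Ck_cst.
by under eq_fun do rewrite big_ord_recr; apply: CkD => //; exact: IH.
Qed.

(** Since [Ck] only speaks of maps between row spaces, the scalar factor appears as a coordinate of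
    a row-valued map. The product rule yields two terms of the same shape, so induction on [k]
    applies. *)
Lemma Ck_scale k n m p (U : set (E n)) (a : E n -> E p) (j : 'I_p)
    (b : E n -> E m) :
  open U -> Ck k U a -> Ck k U b -> Ck k U (fun x => a x 0 j *: b x).
Proof.
move=> oU; elim: k a b => [|k IH] a b.
  move=> ca cb x Ux; apply: continuousZ; last exact: cb.
  apply: (@continuous_comp _ _ _ a (fun M : E p => M 0 j)); first exact: ca.
  exact: coord_continuous.
move=> ca1 cb1; have [da Da] := ca1; have [db Db] := cb1.
have daj x : U x -> differentiable (fun x => a x 0 j : RR^o) x.
  move=> Ux; apply: (@differentiable_comp _ _ _ _ a (fun M : E p => M 0 j : RR^o)).
    exact: da.
  exact: differentiable_coord.
have dbi i x : U x -> differentiable (fun x => b x 0 i : RR^o) x.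
  move=> Ux; apply: (@differentiable_comp _ _ _ _ b (fun M : E m => M 0 i : RR^o)).
    exact: db.
  exact: differentiable_coord.
(* Expanding [b x] in the standard basis reduces the claim to products of real functions times fixed
   vectors. *)
have dab x : U x -> differentiable (fun x => a x 0 j *: b x) x.
  move=> Ux; rewrite (_ : (fun x => _) =
      \sum_i (fun x => (a x 0 j * b x 0 i) *: delta_mx 0 i)).
    apply: differentiable_sum => i; apply: differentiableZl.
    by apply: differentiableM; [exact: daj|exact: dbi].
  apply/funext => y; rewrite fct_sumE [in LHS](row_sum_delta (b y)) scaler_sumr.
  by apply: eq_bigr => i _; rewrite scalerA.
split => // v.
apply: (@Ck_congr _ _ _ _ (fun x => 'D_v a x 0 j *: b x + a x 0 j *: 'D_v b x)) => //.
  move=> x Ux.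
  rewrite [in RHS]derive_mx; last exact/diff_derivable/dab.
  rewrite ['D_v a x]derive_mx; last exact/diff_derivable/da.
  rewrite ['D_v b x]derive_mx; last exact/diff_derivable/db.
  apply/rowP => i; rewrite !mxE.
  have -> : (fun x => (a x 0 j *: b x) 0 i) =
      (fun x => a x 0 j : RR^o) * (fun x => b x 0 i : RR^o).
    by apply/funext => y; rewrite !mxE.
  rewrite deriveM; last 2 first.
  - exact/diff_derivable/daj.
  - exact/diff_derivable/dbi.
  by rewrite addrC [X in _ + X = _]mulrC.
exact: CkD oU (IH _ _ (Da v) (CkW cb1)) (IH _ _ (CkW ca1) (Db v)).
Qed.

Lemma lin_sum_delta n m (f : E n -> E m) : lin f ->
  forall x, f x = \sum_j x 0 j *: f (delta_mx 0 j).
Proof.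
move=> lf x; pose fL : {linear E n -> E m} :=
  HB.pack f (GRing.isLinear.Build _ _ _ _ f lf).
rewrite {1}(row_sum_delta x) -[f]/(fL : E n -> E m) linear_sum.
by apply: eq_bigr => j _; rewrite linearZ.
Qed.

Lemma lin_is_diff n m (f : E n -> E m) x : lin f -> is_diff x f f.
Proof.
move=> lf; pose fL : {linear E n -> E m} :=
  HB.pack f (GRing.isLinear.Build _ _ _ _ f lf).
(* Continuity holds by finite dimension: a linear map is a sum of coordinates times fixed vectors,
   to which the case [k = 0] of [Ck_scale] applies. *)
have cf : continuous fL.
  rewrite (_ : (fL : _ -> _) = fun x => \sum_j x 0 j *: f (delta_mx 0 j)).
    have cid : Ck 0 setT (@idfun (E n)) by move=> y _; exact: cvg_id.
    have /(_ _)/(_ I) // := @Ck_sum 0 n m n setT (fun j x => x 0 j *: f (delta_mx 0 j)) openT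
      (fun j => Ck_scale j openT cid (@Ck_cst 0 n m setT (f (delta_mx 0 j)))).
  by apply/funext => y; exact: lin_sum_delta.
apply: DiffDef; first exact: (linear_differentiable x cf).
exact: (diff_lin x cf).
Qed.

Lemma Ck_lin k n m (U : set (E n)) (f : E n -> E m) : lin f -> Ck k U f.
Proof.
move=> lf; case: k => [|k].
  by move=> x _; apply: differentiable_continuous; have [] := lin_is_diff x lf.
split=> [x _|v]; first by have [] := lin_is_diff x lf.
have -> : 'D_v f = (fun=> f v).
  by apply/funext => x; have [df dfE] := lin_is_diff x lf; rewrite deriveE // dfE.
exact: Ck_cst.
Qed.

(** By the chain rule the derivative along [v] is the sum over [j] of the [j]-th coordinate of
    ['D_v f] times the [j]-th partial of [g] at [f x]. The induction hypothesis is needed for these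
    partials, hence the generality in [g]. *)
Lemma Ck_comp k n m p (U : set (E n)) (V : set (E m)) (f : E n -> E m)
    (g : E m -> E p) :
  open U -> open V -> (forall u, U u -> V (f u)) -> Ck k V g -> Ck k U f ->
  Ck k U (g \o f).
Proof.
move=> oU oV fUV; elim: k g => [|k IH] g.
  by move=> cg cf x Ux; apply: continuous_comp; [exact: cf|exact/cg/fUV].
move=> [dg Dg] cf1; have [df Df] := cf1; split=> [x Ux|v].
  by apply: differentiable_comp; [exact: df|exact/dg/fUV].
apply: (@Ck_congr _ _ _ _
  (fun x => \sum_j 'D_v f x 0 j *: ('D_(delta_mx 0 j) g \o f) x)) => //.
  move=> x Ux; have dfx := df x Ux; have dgx := dg _ (fUV _ Ux).
  rewrite [RHS]deriveE; last exact: differentiable_comp.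
  rewrite diff_comp //= (@lin_sum_delta _ _ ('d g (f x))).
    by apply: eq_bigr => j _; rewrite !deriveE.
  by move=> a y z; rewrite linearP.
apply: Ck_sum => // j; exact: Ck_scale oU (Df v) (IH _ (Dg _) (CkW cf1)).
Qed.

(** * Connectedness of balls *)

Lemma starshaped_connected n (U : set (E n)) :
  (forall x t, U x -> 0 <= t <= 1 -> U (t *: x)) -> connected U.
Proof.
move=> sU.
(* A union of segments that all contain the origin. *)
have -> : U = \bigcup_(x in U) ((fun t : RR => t *: x) @` `[0, 1]).
  apply/seteqP; split=> [x Ux|_ [x Ux [t /= t01 <-]]].
    by exists x => //; exists 1; rewrite ?scale1r //= in_itv /= ler01 lexx.
  by apply: sU => //; move: t01; rewrite in_itv.
apply: bigcup_connected => [|x _].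
  exists 0 => x _; exists 0; rewrite ?scale0r //=.
  by rewrite in_itv /= lexx ler01.
apply: connected_continuous_connected; first exact: segment_connected.
by apply: continuous_subspaceT => t; exact: scalel_continuous.
Qed.

Lemma ball0_connected n (r : RR) : connected (ball (0 : E n) r).
Proof.
apply: starshaped_connected => x t; rewrite -ball_normE /= !sub0r !normrN.
move=> xr /andP[t0 t1]; rewrite normrZ ger0_norm //.
by apply: le_lt_trans xr; rewrite ler_piMl.
Qed.

Lemma ball_connected n (x : E n) (r : RR) : connected (ball x r).
Proof.
have -> : ball x r = (fun y => y + x) @` ball 0 r.
  apply/seteqP; split=> [y xy|_ [y yr <-]].
    exists (y - x); rewrite ?subrK //; move: xy.
    by rewrite -!ball_normE /= sub0r opprB.
  by move: yr; rewrite -!ball_normE /= sub0r opprD addrCA subrr addr0.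
apply: connected_continuous_connected; first exact: ball0_connected.
apply: continuous_subspaceT => y.
by apply: (@continuousD _ _ _ id (fun=> x)); [exact: cvg_id|exact: cst_continuous].
Qed.

Lemma open_ballP n (U : set (E n)) x : open U -> U x ->
  exists2 r : RR, 0 < r & ball x r `<=` U.
Proof. by move=> oU Ux; apply/nbhs_ballP/open_nbhs_nbhs. Qed.

Lemma open_ball_shift n (U : set (E n)) (u : E n) : open U -> U u ->
  exists2 r : RR, 0 < r & forall y, ball 0 r y -> U (y + u).
Proof.
move=> oU Uu; have [r r0 rU] := open_ballP oU Uu; exists r => // y yr; apply: rU.
by move: yr; rewrite -!ball_normE /= sub0r opprD addrCA subrr addr0.
Qed.

(** * Smooth maps on an open set *)

Section Smooth.
Variables (n m : nat) (U : set (E n)).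
Hypothesis oU : open U.

Lemma smooth_cst (c : E m) : smooth U (fun _ => c).
Proof. by move=> k; exact: Ck_cst. Qed.

Lemma smooth_lin (f : E n -> E m) : lin f -> smooth U f.
Proof. by move=> lf k; exact: Ck_lin. Qed.

Lemma smoothD (f g : E n -> E m) :
  smooth U f -> smooth U g -> smooth U (fun x => f x + g x).
Proof. by move=> sf sg k; exact: CkD. Qed.

Lemma smooth_scale p (a : E n -> E p) j (b : E n -> E m) :
  smooth U a -> smooth U b -> smooth U (fun x => a x 0 j *: b x).
Proof. by move=> sa sb k; exact: Ck_scale. Qed.

Lemma smooth_comp p (V : set (E m)) (f : E n -> E m) (g : E m -> E p) :
  open V -> (forall u, U u -> V (f u)) -> smooth V g -> smooth U f ->
  smooth U (g \o f).
Proof. by move=> oV UV sg sf k; exact: Ck_comp oU oV UV (sg k) (sf k). Qed.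

Lemma smooth_differentiable (f : E n -> E m) x :
  smooth U f -> U x -> differentiable f x.
Proof. by move=> /(_ 1) [df _] /df. Qed.

Lemma smooth_preimage_open (f : E n -> E m) (V : set (E m)) :
  smooth U f -> open V -> open [set x | U x /\ V (f x)].
Proof.
move=> /(_ 0) cf oV; rewrite openE => x [Ux Vfx].
have nV : \forall y \near x, V (f y).
  by apply: (cf x Ux); exact: open_nbhs_nbhs.
have nU : \forall y \near x, U y by exact: open_nbhs_nbhs.
by apply: filterS2 nU nV.
Qed.

End Smooth.

Lemma smooth_sub n m (U W : set (E n)) (f : E n -> E m) :
  W `<=` U -> smooth U f -> smooth W f.
Proof.
move=> WU sf k; move: (sf k); elim: k f {sf} => [|k IH] f.
  by move=> cf x /WU; exact: cf.
by move=> [df Df]; split=> [x /WU/df //|v]; exact: IH (Df v).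
Qed.

Lemma lin_id n : lin (fun x : E n => x).
Proof. by []. Qed.

Lemma lin_lsubmx n m : lin (fun z : E (n + m) => lsubmx z).
Proof. by move=> a x y; rewrite linearP. Qed.

Lemma lin_rsubmx n m : lin (fun z : E (n + m) => rsubmx z).
Proof. by move=> a x y; rewrite linearP. Qed.

Lemma lin_row_mxl n m : lin (fun x : E n => row_mx x (0 : E m)).
Proof. by move=> a x y; rewrite scale_row_mx add_row_mx scaler0 addr0. Qed.

Lemma lin_row_mxr n m : lin (fun x : E m => row_mx (0 : E n) x).
Proof. by move=> a x y; rewrite scale_row_mx add_row_mx scaler0 addr0. Qed.

Lemma lin_preimage_open n m (f : E n -> E m) (V : set (E m)) :
  lin f -> open V -> open [set x | V (f x)].
Proof.
move=> lf oV; have := smooth_preimage_open openT (@smooth_lin _ _ setT _ lf) oV.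
by congr open; apply/seteqP; split=> [x []|x].
Qed.

Lemma smooth_row_mx n m p (U : set (E p)) (a : E p -> E n) (b : E p -> E m) :
  open U -> smooth U a -> smooth U b -> smooth U (fun x => row_mx (a x) (b x)).
Proof.
move=> oU sa sb.
have -> : (fun x => row_mx (a x) (b x)) =
    (fun x => ((fun y => row_mx y 0) \o a) x + ((fun y => row_mx 0 y) \o b) x).
  by apply/funext => x /=; rewrite add_row_mx addr0 add0r.
apply: smoothD => //.
  by apply: (smooth_comp oU openT) => //; apply/smooth_lin/lin_row_mxl.
by apply: (smooth_comp oU openT) => //; apply/smooth_lin/lin_row_mxr.
Qed.

(** * Diffeologies and tangent vectors *)

Section Diffeology.
Variables (X : Type) (P : plots X).
Hypothesis dP : is_diffeology P.

Lemma plot_open n U (p : E n -> X) : P U p -> open U.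
Proof. by case: dP => + _; exact. Qed.

Lemma plot_congr n U (p q : E n -> X) :
  P U p -> (forall u, U u -> p u = q u) -> P U q.
Proof. by case: dP => _ [+ _]; exact. Qed.

Lemma plot_cst n (U : set (E n)) (x : X) : open U -> P U (fun _ => x).
Proof. by case: dP => _ [_ [+ _]]; exact. Qed.

Lemma plot_comp n m (U : set (E n)) (V : set (E m)) p f :
  open U -> P V p -> smooth U f -> (forall u, U u -> V (f u)) -> P U (p \o f).
Proof. by case: dP => _ [_ [_ [+ _]]]; exact. Qed.

Lemma plot_local n (U : set (E n)) p : open U ->
  (forall u, U u -> exists W : set (E n), [/\ open W, W u, W `<=` U & P W p]) ->
  P U p.
Proof. by case: dP => _ [_ [_ [_ +]]]; exact. Qed.

Lemma plot_sub n (U V : set (E n)) p : open U -> U `<=` V -> P V p -> P U p.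
Proof.
by move=> oU UV Pp; apply: (plot_comp oU Pp _ UV); exact/smooth_lin/lin_id.
Qed.

End Diffeology.

(** * Linear subspaces as vector spaces *)

Section Subspace.
Variables (V : lmodType RR) (S : set V).
Hypotheses (S0 : S 0) (SP : forall a x y, S x -> S y -> S (a *: x + y)).

(** The closure proofs are arguments so that the module structure on [subspace_of] can be inferred
    from the type alone. *)
Definition in_subspace of S 0 & (forall a x y, S x -> S y -> S (a *: x + y)) :
  {pred V} := [pred x | `[< S x >]].

Definition subspace_of := {x : V | in_subspace S0 SP x}.

Let in_subspace_submod : submod_closed (in_subspace S0 SP).
Proof.
split=> [|a x y]; first exact/asboolP.
by move=> /asboolP Sx /asboolP Sy; apply/asboolP; exact: SP.
Qed.

HB.instance Definition _ :=
  GRing.isSubmodClosed.Build RR V (in_subspace S0 SP) in_subspace_submod.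
HB.instance Definition _ := SubChoice.on subspace_of.
HB.instance Definition _ := [SubChoice_isSubLmodule of subspace_of by <:].

End Subspace.

Lemma derive_translate (K : numFieldType) (V W : normedModType K) (f : V -> W)
    (a v : V) (c : W) : 'D_v (fun y => f (y + a) + c) 0 = 'D_v f a.
Proof.
rewrite /derive.
have -> : (fun h => h^-1 *: (((fun y => f (y + a) + c) \o shift 0) (h *: v)
    - (f (0 + a) + c))) = (fun h => h^-1 *: ((f \o shift a) (h *: v) - f a)) => //.
by apply/funext => h /=; rewrite !(addr0, add0r) opprD addrACA subrr addr0.
Qed.

Section Tangent.
Variables (X : Type) (P : plots X) (T : X -> lmodType RR).
Variable iota : forall x n, set (E n) -> (E n -> X) -> E n -> T x.
Hypothesis dP : is_diffeology P.
Hypothesis colim : forall x, is_tangent_colimit P x (iota x).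

Lemma iota_lin x n (U : set (E n)) p : pointed P x U p -> lin (iota x U p).
Proof. by have [[+ _] _] := colim x; exact. Qed.

Lemma iota_natural x n m (U : set (E n)) (V : set (E m)) p q f v :
  pointed P x U p -> pointed P x V q -> plot_mor U V p q f ->
  iota x V q ('d f 0 v) = iota x U p v.
Proof. by have [[_ +] _] := colim x => iotaN pU qV fUV; exact: iotaN. Qed.

(** Both plots restrict to the same plot on a small ball, and each inclusion of that ball is a
    morphism whose differential at 0 is the identity. *)
Lemma iota_germ x n (U V : set (E n)) p q v :
  pointed P x U p -> pointed P x V q -> (forall y, U y -> V y -> p y = q y) ->
  iota x U p v = iota x V q v.
Proof.
move=> pU qV pq.
have [PU _ U0 p0] := pU; have [PV _ V0 q0] := qV.
have oU := plot_open dP PU; have oV := plot_open dP PV.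
have [r r0 rUV] := open_ballP (openI oU oV) (conj U0 V0).
have rU : pointed P x (ball 0 r) p.
  split=> //; first by apply: plot_sub PU => //; [exact: ball_open|move=> y /rUV[]].
    exact: ball_connected.
  exact: ballxx.
have sid : smooth (ball (0 : E n) r) id by exact/smooth_lin/lin_id.
have did : 'd id (0 : E n) v = v by rewrite diff_val.
transitivity (iota x (ball 0 r) p v).
  rewrite -{1}did; apply: iota_natural => //.
  by split=> // y /rUV[].
apply/esym; rewrite -{1}did; apply: iota_natural => //.
by split=> // y /rUV[] // Uy Vy; rewrite pq.
Qed.

(* The domain of the germ of [F] at [u] used to define tangent vectors: any
   ball will do by [iota_germ], and choosing one makes [tanv] independent of
   the domain of [F], which need not be connected. *)
Definition germ_dom n (F : E n -> X) (u : E n) : set (E n) :=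
  xget setT [set B | exists2 r : RR, 0 < r &
                     B = ball 0 r /\ P B (fun y => F (y + u))].

Definition tanv x n (F : E n -> X) (u v : E n) : T x :=
  iota x (germ_dom F u) (fun y => F (y + u)) v.

Lemma smooth_shift n (U : set (E n)) (u : E n) :
  open U -> smooth U (fun y => y + u).
Proof.
by move=> oU; apply: smoothD => //; [exact/smooth_lin/lin_id|exact: smooth_cst].
Qed.

Lemma plot_shift n (V : set (E n)) F (u : E n) (r : RR) :
  P V F -> (forall y, ball 0 r y -> V (y + u)) ->
  P (ball 0 r) (fun y => F (y + u)).
Proof.
move=> PV rV; apply: (plot_comp dP (f := fun y => y + u) _ PV) => //.
  exact: ball_open.
by apply: smooth_shift; exact: ball_open.
Qed.

Lemma germ_domP n (V : set (E n)) F u : P V F -> V u ->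
  exists2 r : RR, 0 < r &
    germ_dom F u = ball 0 r /\ P (ball 0 r) (fun y => F (y + u)).
Proof.
move=> PV Vu; have [r r0 rV] := open_ball_shift (plot_open dP PV) Vu.
rewrite /germ_dom; case: xgetP => [_ -> [s s0 [-> Ps]]|/(_ (ball 0 r))].
  by exists s.
by case; exists r => //; split => //; exact: plot_shift PV rV.
Qed.

Lemma germ_pointed x n (V : set (E n)) F u :
  P V F -> V u -> F u = x -> pointed P x (germ_dom F u) (fun y => F (y + u)).
Proof.
move=> PV Vu Fu; have [r r0 [-> Pr]] := germ_domP PV Vu; split=> //.
- exact: ball_connected.
- exact: ballxx.
- by rewrite add0r.
Qed.

Lemma tanv_lin x n (V : set (E n)) F u :
  P V F -> V u -> F u = x -> lin (tanv x F u).
Proof. by move=> PV Vu Fu; apply: iota_lin; exact: germ_pointed PV Vu Fu. Qed.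

Lemma tanv_iota x n (U V : set (E n)) p F u v :
  pointed P x U p -> P V F -> V u -> F u = x ->
  (forall y, U y -> p y = F (y + u)) -> tanv x F u v = iota x U p v.
Proof.
move=> pU PV Vu Fu pF; apply: iota_germ => //.
  exact: germ_pointed PV Vu Fu.
by move=> y _ Uy; rewrite pF.
Qed.

Lemma tanv_natural x n m (U : set (E n)) (V : set (E m)) f F phi u v :
  P U f -> P V F -> smooth U phi -> (forall y, U y -> V (phi y)) ->
  (forall y, U y -> F (phi y) = f y) -> U u -> f u = x ->
  tanv x F (phi u) ('d phi u v) = tanv x f u v.
Proof.
move=> PU PV sphi UV Ff Uu fu; have oU := plot_open dP PU.
have Fx : F (phi u) = x by rewrite Ff.
have gF := germ_pointed PV (UV _ Uu) Fx.
have [s s0 [gE _]] := germ_domP PV (UV _ Uu).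
(* [phi] recentred at the origin. On a ball small enough to be sent into the germ domain of [F] at
   [phi u], it is a morphism of pointed plots with the same differential as [phi] at [u]. *)
pose psi y := phi (y + u) + - phi u.
have oW : open [set y | U y /\ ball (phi u) s (phi y)].
  by apply: smooth_preimage_open => //; exact: ball_open.
have [r r0 rW] := open_ball_shift oW (conj Uu (ballxx _ s0)).
have ob : open (ball (0 : E n) r) by exact: ball_open.
have rP : pointed P x (ball 0 r) (fun y => f (y + u)).
  split; [|exact: ball_connected|exact: ballxx|by rewrite add0r].
  by apply: plot_shift PU _ => y /rW[].
have spsi : smooth (ball 0 r) psi.
  apply: smoothD => //; last exact: smooth_cst.
  apply: (smooth_comp ob oU (f := fun y => y + u)) => //.
    by move=> y /rW[].
  exact: smooth_shift.
have -> : 'd phi u v = 'd psi 0 v.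
  have dphi := smooth_differentiable sphi Uu.
  have dpsi : differentiable psi 0.
    by apply: (smooth_differentiable spsi); exact: ballxx.
  apply: etrans (esym (deriveE v dphi)) _; apply: etrans _ (deriveE v dpsi).
  exact/esym/derive_translate.
rewrite [RHS](tanv_iota v rP PU Uu fu) //; apply: iota_natural => //.
split=> // [y /rW[Uy yB]||y /rW[Uy _]].
- rewrite gE; move: yB; rewrite -!ball_normE /= sub0r.
  by rewrite /psi opprB.
- by rewrite /psi add0r subrr.
- by rewrite /psi subrK Ff.
Qed.

(** * The tangent bundle and the local form of Hector's diffeology *)

Definition tvec n (F : E n -> X) (u v : E n) : {x : X & T x} :=
  existT (fun x => T x) (F u) (tanv (F u) F u v).

Lemma tvecE x n (F : E n -> X) (u v : E n) : F u = x ->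
  tvec F u v = existT (fun x => T x) x (tanv x F u v).
Proof. by move=> <-. Qed.

Lemma tmap_tvec n (U : set (E n)) f w : P U f -> connected U ->
  U (lsubmx w) -> tmap iota U f w = tvec f (lsubmx w) (rsubmx w).
Proof.
move=> PU cU Uw; rewrite /tmap /tvec; congr existT.
(* It remains to see that the translate of [U] is a legitimate pointed domain: it is open as a
   preimage under a shift and connected as an image under the opposite shift. *)
apply/esym/(tanv_iota _ _ PU Uw) => //.
have oU := plot_open dP PU.
pose U' := [set y | setT y /\ U (y + lsubmx w)].
have U'E : [set y | U (y + lsubmx w)] = U'.
  by apply/seteqP; split => [y //|y []].
have oU' : open U'.
  apply: (@smooth_preimage_open _ _ setT openT (fun y => y + lsubmx w)) => //.
  exact: smooth_shift openT.
rewrite U'E; split; [ | | | by rewrite add0r].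
- apply: (plot_comp dP (f := fun y => y + lsubmx w) oU' PU) => [|y []//].
  exact: smooth_shift.
- have -> : U' = (fun y => y - lsubmx w) @` U.
    apply/seteqP; split => [y [_ Uy]|_ [y Uy <-]].
      by exists (y + lsubmx w); rewrite ?addrK.
    by rewrite /U' /= subrK.
  apply: connected_continuous_connected => //; apply: continuous_subspaceT => y.
  apply: (@continuousD _ _ _ id (fun=> - lsubmx w)); first exact: cvg_id.
  exact: cst_continuous.
- by rewrite /U' /= add0r.
Qed.

Lemma is_diffeology_hector : is_diffeology (hector_plots P iota).
Proof.
split; [|split; [|split; [|split]]].
(* Openness of the domain is tested against one particular diffeology, the coarse one, whose plots
   are all maps with open domain. *)
- move=> n U p hp; apply: (hp (fun n U _ => open U)).
    split=> //; split=> //; split=> //; split=> // n' U' f [_ _ _ +]//.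
  move=> n' U' f PU _.
  exact: lin_preimage_open (@lin_lsubmx n' n') (plot_open dP PU).
- move=> n U p q hp pq Q dQ gQ; exact: plot_congr dQ _ _ _ _ (hp Q dQ gQ) pq.
- by move=> n U x oU Q dQ gQ; exact: plot_cst dQ _ _ _ oU.
- move=> n m U V p f oU hp sf UV Q dQ gQ.
  exact: plot_comp dQ _ _ _ _ _ _ oU (hp Q dQ gQ) sf UV.
- move=> n U p oU locp Q dQ gQ; apply: (plot_local dQ) => // u /locp.
  by move=> [W [oW Wu WU hp]]; exists W; split => //; exact: hp.
Qed.

(** The generators live on connected domains, while [V] is arbitrary. Near each [w0] the map is a
    generator over a ball in [V] composed with the smooth map [(a, b)], and the sheaf condition
    glues these pieces. *)
Lemma hector_tvec m (W : set (E m)) n (V : set (E n)) F a b :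
  open W -> P V F -> smooth W a -> smooth W b -> (forall w, W w -> V (a w)) ->
  hector_plots P iota m W (fun w => tvec F (a w) (b w)).
Proof.
move=> oW PV sa sb WV; apply: (plot_local is_diffeology_hector) => // w0 Ww0.
have [r r0 rV] := open_ballP (plot_open dP PV) (WV _ Ww0).
have PB : P (ball (a w0) r) F by apply: plot_sub PV => //; exact: ball_open.
have oB : open (ball (a w0) r) by exact: ball_open.
have oW' := smooth_preimage_open oW sa oB.
exists [set w | W w /\ ball (a w0) r (a w)]; split=> //.
- by split => //; exact: ballxx.
- by move=> w [].
move=> Q dQ gQ; have cB := @ball_connected n (a w0) r.
have := plot_comp dQ (f := fun w => row_mx (a w) (b w)) oW' (gQ _ _ _ PB cB).
move=> QF; apply: (plot_congr dQ (QF _ _)).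
- by apply: smooth_row_mx => //; [apply: smooth_sub sa|apply: smooth_sub sb];
    move=> w [].
- by move=> w [Ww aw]; rewrite /tset /= row_mxKl.
- by move=> w [Ww aw] /=; rewrite tmap_tvec // ?row_mxKl ?row_mxKr.
Qed.

(* The explicit local form of the generated diffeology; constants are covered
   because every tangent vector is assumed to come from a single plot. *)
Definition tvec_plots : plots {x : X & T x} := fun m W p =>
  open W /\ forall w, W w -> exists (W' : set (E m)) n (V : set (E n)) F a b,
    [/\ [/\ open W', W' w & W' `<=` W], P V F,
        smooth W' a /\ smooth W' b, forall y, W' y -> V (a y)
      & forall y, W' y -> p y = tvec F (a y) (b y)].

Hypothesis tanv_surj : forall x (t : T x), exists n (V : set (E n)) F u v,
  [/\ P V F, V u, F u = x & t = tanv x F u v].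

Lemma is_diffeology_tvec_plots : is_diffeology tvec_plots.
Proof.
split; [by move=> ? ? ? []|split; [|split; [|split]]].
- move=> m W p q [oW hp] pq; split=> // w /hp [W' [n [V [F [a [b [+ PV sab WV pE]]]]]]].
  move=> [oW' W'w W'W]; exists W', n, V, F, a, b; split=> [//|//|//|//|y W'y].
  by rewrite -pq ?pE //; exact: W'W.
- move=> m W [x t] oW; split=> // w Ww.
  have [n [V [F [u [v [PV Vu Fu ->]]]]]] := tanv_surj t.
  exists W, n, V, F, (fun=> u), (fun=> v); split=> //; first by split.
    by split; exact: smooth_cst.
  by move=> y _; rewrite (tvecE _ Fu).
- move=> n m U W p f oU [oW hp] sf UW; split=> // u Uu.
  have [W' [k [V [F [a [b [[oW' W'w W'W] PV [sa sb] WV pE]]]]]]] := hp _ (UW _ Uu).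
  have oU' := smooth_preimage_open oU sf oW'.
  have sf' : smooth [set x | U x /\ W' (f x)] f by apply: smooth_sub sf => y [].
  exists [set x | U x /\ W' (f x)], k, V, F, (a \o f), (b \o f); split=> //.
  + by split=> // y [].
  + by split; apply: (smooth_comp oU' oW') => // y [].
  + by move=> y [_ W'y]; exact: WV.
  + by move=> y [_ W'y] /=; rewrite pE.
- move=> m W p oW locp; split=> // w /locp [W1 [oW1 W1w W1W [_ /(_ _ W1w)]]].
  move=> [W' [n [V [F [a [b [[oW' W'w W'W] PV sab WV pE]]]]]]].
  exists W', n, V, F, a, b; split=> //; split=> //; exact: subset_trans W1W.
Qed.

Lemma hector_local m (W : set (E m)) p :
  hector_plots P iota m W p -> tvec_plots W p.
Proof.
move=> hp; apply: hp; first exact: is_diffeology_tvec_plots.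
move=> n U f PU cU; have oU := plot_open dP PU.
have oT : open (tset U) by exact: lin_preimage_open (@lin_lsubmx n n) oU.
split=> // w Uw; exists (tset U), n, U, f, lsubmx, rsubmx; split=> //; first by split.
  by split; apply: smooth_lin; [exact: lin_lsubmx|exact: lin_rsubmx].
by move=> y Uy; exact: tmap_tvec.
Qed.

End Tangent.

(** * Linear maps, dependent pairs and affine differentials *)

Lemma lin0 (V W : lmodType RR) (h : V -> W) : lin h -> h 0 = 0.
Proof. by move=> lh; have := lh (-1) 0 0; rewrite scaler0 addr0 scaleN1r addNr. Qed.

Lemma linD (V W : lmodType RR) (h : V -> W) u v : lin h -> h (u + v) = h u + h v.
Proof. by move=> lh; have := lh 1 u v; rewrite !scale1r. Qed.

Lemma linZ (V W : lmodType RR) (h : V -> W) a u : lin h -> h (a *: u) = a *: h u.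
Proof. by move=> lh; have := lh a u 0; rewrite (lin0 lh) !addr0. Qed.

Lemma existT_inj (X : Type) (F : X -> Type) x (t t' : F x) :
  existT F x t = existT F x t' -> t = t'.
Proof.
move=> tt'; have := projT2_eq tt'.
by rewrite (Prop_irrelevance (projT1_eq tt') erefl).
Qed.

(** Once both vectors are known to lie over the same [x], the transport in [fib_add] is along a
    proof of [x = x], which proof irrelevance turns into [erefl]. *)
Lemma fib_addE (X : Type) (F : X -> lmodType RR) (s : fib_pairs F) x
    (t t' : F x) :
  (sval s).1 = existT (fun x => F x) x t ->
  (sval s).2 = existT (fun x => F x) x t' ->
  fib_add s = existT (fun x => F x) x (t + t').
Proof.
case: s => [[p q] pq] /= pE qE; subst p q; rewrite /fib_add /=.
by rewrite (Prop_irrelevance (esym _) erefl).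
Qed.

Lemma plot_lin (X : Type) (P : plots X) n m (U : set (E n)) (V : set (E m)) f p :
  is_diffeology P -> open U -> P m V p -> lin f -> (forall u, U u -> V (f u)) ->
  P n U (fun u => p (f u)).
Proof.
by move=> dP oU PV lf UV; apply: (plot_comp dP oU PV _ UV); exact: smooth_lin.
Qed.

Lemma diff_affine n m (L : E n -> E m) c u v :
  lin L -> 'd (fun y => L y + c) u v = L v.
Proof.
move=> lL; have [_ ->] := is_diffD (lin_is_diff u lL) (is_diff_cst c u).
by rewrite [LHS]addr0.
Qed.

(** * Diffeological groups *)

Section Group.
Variables (G : Type) (P : plots G) (mul : G -> G -> G) (inv : G -> G) (e : G).
Variables (T : G -> lmodType RR).
Variable iota : forall x n, set (E n) -> (E n -> G) -> E n -> T x.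
Hypothesis dG : is_diffeological_group P mul inv e.
Hypothesis colim : forall x, is_tangent_colimit P x (iota x).

Local Notation H := (hector_plots P iota).
Local Notation tanv := (tanv P iota).
Local Notation tvec := (tvec P iota).

Let dP : is_diffeology P. Proof. by case: dG. Qed.
Let mulA a b c : mul a (mul b c) = mul (mul a b) c.
Proof. by case: dG => _ []. Qed.
Let mul1 a : mul e a = a. Proof. by case: dG => _ [_ /(_ a)[]]. Qed.
Let mule a : mul a e = a. Proof. by case: dG => _ [_ /(_ a)[]]. Qed.
Let mulV a : mul (inv a) a = e. Proof. by case: dG => _ [_ _ /(_ a)[]]. Qed.
Let mulVr a : mul a (inv a) = e. Proof. by case: dG => _ [_ _ /(_ a)[]]. Qed.

Lemma plot_mul n (U : set (E n)) f g :
  P U f -> P U g -> P U (fun u => mul (f u) (g u)).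
Proof.
move=> Pf Pg; case: dG => _ [_ _ _ smul _].
exact: (smul n U (fun u => (f u, g u)) (conj Pf Pg)).
Qed.

Lemma plot_inv n (U : set (E n)) f : P U f -> P U (fun u => inv (f u)).
Proof. by move=> Pf; case: dG => _ [_ _ _ _ /(_ _ U f Pf)]. Qed.

Lemma plot_mull g n (U : set (E n)) p : P U p -> P U (fun y => mul g (p y)).
Proof.
by move=> Pp; apply: plot_mul => //; exact/(plot_cst dP)/(plot_open dP Pp).
Qed.

(** The form of naturality used below, where every change of variables is the inclusion of an affine
    coordinate slice. *)
Lemma tanv_affine x n m (U : set (E n)) (V : set (E m)) f F L c u v :
  P U f -> P V F -> lin L -> (forall y, U y -> V (L y + c)) ->
  (forall y, U y -> F (L y + c) = f y) -> U u -> f u = x ->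
  tanv x F (L u + c) (L v) = tanv x f u v.
Proof.
move=> PU PV lL UV Ff Uu fu; rewrite -[X in tanv _ _ _ X](diff_affine c u v lL).
apply: (tanv_natural dP colim v PU PV (phi := fun y => L y + c)) => //.
apply: smoothD; first exact: plot_open PU.
  exact: smooth_lin.
exact: smooth_cst.
Qed.

(** * Addition of tangent vectors *)

Definition add_plot n m (f : E n -> G) (g : E m -> G) (z : E (n + (m + m))) : G :=
  mul (mul (f (lsubmx z)) (inv (g (lsubmx (rsubmx z))))) (g (rsubmx (rsubmx z))).

Definition add_dom n m (U : set (E n)) (V : set (E m)) : set (E (n + (m + m))) :=
  [set z | [/\ U (lsubmx z), V (lsubmx (rsubmx z)) & V (rsubmx (rsubmx z))]].

Lemma plot_add n m (U : set (E n)) (V : set (E m)) f g :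
  P U f -> P V g -> P (add_dom U V) (add_plot f g).
Proof.
move=> Pf Pg; have oU := plot_open dP Pf; have oV := plot_open dP Pg.
have l1 : lin (fun z : E (n + (m + m)) => lsubmx z) by exact: lin_lsubmx.
have l2 : lin (fun z : E (n + (m + m)) => lsubmx (rsubmx z)).
  by move=> a y z; rewrite !linearP.
have l3 : lin (fun z : E (n + (m + m)) => rsubmx (rsubmx z)).
  by move=> a y z; rewrite !linearP.
have oD : open (add_dom U V).
  have := openI (lin_preimage_open l1 oU)
    (openI (lin_preimage_open l2 oV) (lin_preimage_open l3 oV)).
  by congr open; apply/seteqP; split=> [z [? []]|z []].
apply: plot_mul; first apply: plot_mul; last 1 first.
- by apply: (plot_lin dP oD Pg l3) => z [].
- by apply: (plot_lin dP oD Pf l1) => z [].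
- by apply/plot_inv/(plot_lin dP oD Pg l2) => z [].
Qed.

(* At a point [(u, w, w)] with [f u = g w] the factor [inv (g w)] cancels
   either neighbour, so [add_plot f g] restricts to [f] and to [g] along the
   first and the third coordinate axis. *)
Lemma tanvD x n m (U : set (E n)) (V : set (E m)) f g u w v v' :
  P U f -> P V g -> U u -> V w -> f u = x -> g w = x ->
  tanv x f u v + tanv x g w v' =
  tanv x (add_plot f g) (row_mx u (row_mx w w)) (row_mx v (row_mx 0 v')).
Proof.
move=> Pf Pg Uu Vw fu gw; have PD := plot_add Pf Pg.
have Dz : add_dom U V (row_mx u (row_mx w w)).
  by rewrite /add_dom /= row_mxKr !row_mxKl row_mxKr.
have Dx : add_plot f g (row_mx u (row_mx w w)) = x.
  by rewrite /add_plot row_mxKr !row_mxKl row_mxKr -mulA mulV mule.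
have ld := tanv_lin dP colim PD Dz Dx.
have -> : row_mx v (row_mx 0 v') =
    row_mx v 0 + row_mx 0 (row_mx 0 v') :> E (n + (m + m)).
  by rewrite add_row_mx addr0 add0r.
rewrite (linD _ _ ld); congr (_ + _).
  have := @tanv_affine x _ _ U _ f _ (fun y : E n => row_mx y (0 : E (m + m)))
    (row_mx 0 (row_mx w w)) u v Pf PD (@lin_row_mxl _ _).
  rewrite add_row_mx addr0 add0r => -> // y Uy; rewrite add_row_mx addr0 add0r.
    by rewrite /add_dom /= row_mxKr !row_mxKl row_mxKr.
  by rewrite /add_plot row_mxKr !row_mxKl row_mxKr -mulA mulV mule.
have lL : lin (fun y : E m => row_mx (0 : E n) (row_mx (0 : E m) y)).
  by move=> a y z; rewrite !scale_row_mx !add_row_mx !scaler0 !addr0.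
have := @tanv_affine x _ _ V _ g _ _ (row_mx u (row_mx w 0)) w v' Pg PD lL.
rewrite !add_row_mx addr0 !add0r => -> // y Vy; rewrite !add_row_mx addr0 !add0r.
  by rewrite /add_dom /= row_mxKr !row_mxKl row_mxKr.
by rewrite /add_plot row_mxKr !row_mxKl row_mxKr fu gw mulVr mul1.
Qed.

(* The vectors [tanv x F u v] form a subspace, through which the identity of
   the colimit [T x] must factor. *)
Lemma tanv_surj x (t : T x) : exists n (V : set (E n)) F u v,
  [/\ P V F, V u, F u = x & t = tanv x F u v].
Proof.
pose S := [set t : T x | exists n (V : set (E n)) F u v,
  [/\ P V F, V u, F u = x & t = tanv x F u v]].
have S0 : S 0.
  have Pc : P setT (fun _ : E 0 => x) by apply: plot_cst => //; exact: openT.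
  exists 0, setT, (fun=> x), 0, 0; split=> //.
  by rewrite (lin0 (tanv_lin dP colim Pc (u := 0) _ _)).
have SP a t1 t2 : S t1 -> S t2 -> S (a *: t1 + t2).
  move=> [n [U [f [u [v [Pf Uu fu ->]]]]]] [m [V [g [w [v' [Pg Vw gw ->]]]]]].
  exists (n + (m + m))%N, (add_dom U V), (add_plot f g), (row_mx u (row_mx w w)),
    (row_mx (a *: v) (row_mx 0 v')); split; first exact: plot_add.
  - by rewrite /add_dom /= row_mxKr !row_mxKl row_mxKr.
  - by rewrite /add_plot row_mxKr !row_mxKl row_mxKr -mulA mulV mule.
  - rewrite -(linZ _ _ (tanv_lin dP colim Pf Uu fu)).
    exact: tanvD Pf Pg Uu Vw fu gw.
have iotaS n (U : set (E n)) p v : pointed P x U p -> S (iota x U p v).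
  move=> pU; have [PU _ U0 p0] := pU; exists n, U, p, 0, v; split=> //.
  by apply/esym/(tanv_iota dP colim _ pU PU) => // y _; rewrite addr0.
pose W : lmodType RR := subspace_of S0 SP.
(* On pointed plots the value lies in [S] by [iotaS]; the default [0] can occur only elsewhere,
   where the cocone conditions say nothing. *)
pose phi n (U : set (E n)) (p : E n -> G) v : W := insubd (0 : W) (iota x U p v).
have phiE n U p v : pointed P x U p -> val (phi n U p v) = iota x U p v.
  by move=> pU; rewrite /phi insubdK //; apply/asboolP; exact: iotaS.
have cphi : cocone P x phi.
  split=> [n U p pU a v w|n m U V p q f pU qV fUV v]; apply: val_inj.
    rewrite -[RHS]/(a *: val (phi n U p v) + val (phi n U p w)).
    by rewrite !phiE // (iota_lin colim pU).
  by rewrite !phiE // (iota_natural colim _ pU qV fUV).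
have [_ univ] := colim x.
(* [h] maps the colimit into the subspace, and [h0] is the unique endomorphism compatible with
   [iota]. Both the identity and [val \o h] are compatible, so [t = h0 t = val (h t)] lies in
   [S]. *)
have [h [lh hE _]] := univ W phi cphi.
have [h0 [_ _ h0U]] := univ (T x) (iota x) (colim x).1.
have idE : t = h0 t by apply: (h0U id).
have hE' : val (h t) = h0 t.
  apply: (h0U (fun t => val (h t))) => [a v w|n U p pU v].
    by rewrite lh linearP.
  by rewrite hE // phiE.
have : in_subspace S0 SP (val (h t)) := valP (h t).
by rewrite hE' -idE => /asboolP.
Qed.

(** * Hector's diffeology is a vector space diffeology *)

Let dH : is_diffeology H.
Proof. exact: is_diffeology_hector. Qed.

(** An elimination principle: being a plot is local, so a plot [q] built from [p] may be examined
    where [p] has the form [tvec F (a y) (b y)]. *)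
Lemma hector_ind (Y : Type) (Q : plots Y) m (W : set (E m)) p q :
  is_diffeology Q -> H m W p ->
  (forall (W' : set (E m)) n (V : set (E n)) F a b,
    open W' -> W' `<=` W -> P V F -> smooth W' a -> smooth W' b ->
    (forall y, W' y -> V (a y)) ->
    (forall y, W' y -> p y = tvec F (a y) (b y)) -> Q m W' q) ->
  Q m W q.
Proof.
move=> dQ Hp locQ; apply: (plot_local dQ); first exact: plot_open dH _ _ _ Hp.
have [_ loc] := hector_local dP colim tanv_surj Hp.
move=> w /loc [W' [n [V [F [a [b [[oW' W'w W'W] PV [sa sb] WV pE]]]]]]].
by exists W'; split=> //; exact: (locQ W' n V F a b).
Qed.

Lemma hector_proj m (W : set (E m)) p : H m W p -> P W (fun w => projT1 (p w)).
Proof.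
move=> Hp; apply: (hector_ind dP Hp) => W' n V F a b oW' _ PV sa sb WV pE.
by apply: (plot_congr dP (plot_comp dP oW' PV sa WV)) => y /pE /= ->.
Qed.

Lemma hector_fib_add m (W : set (E m)) (s : E m -> fib_pairs T) :
  H m W (fun w => (sval (s w)).1) -> H m W (fun w => (sval (s w)).2) ->
  H m W (fun w => fib_add (s w)).
Proof.
move=> H1 H2.
apply: (hector_ind dH H1) => W1 n1 V1 F1 a1 b1 oW1 W1W P1 sa1 sb1 WV1 E1.
have H2' : H m W1 (fun w => (sval (s w)).2) by exact: plot_sub dH _ _ _ _ oW1 W1W H2.
apply: (hector_ind dH H2') => W2 n2 V2 F2 a2 b2 oW2 W12 P2 sa2 sb2 WV2 E2.
have PD := plot_add P1 P2.
have sa1' := smooth_sub W12 sa1; have sb1' := smooth_sub W12 sb1.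
(* The plot, point and direction of [tanvD], with point and direction now varying smoothly with
   [w]. *)
have HD := @hector_tvec _ _ _ iota dP colim m W2 _ _ _
  (fun w => row_mx (a1 w) (row_mx (a2 w) (a2 w)))
  (fun w => row_mx (b1 w) (row_mx 0 (b2 w))) oW2 PD.
apply: (plot_congr dH (HD _ _ _)).
- by do 2 (apply: smooth_row_mx => //).
- by do 2 (apply: smooth_row_mx => //); exact: smooth_cst.
- move=> w W2w; rewrite /add_dom /= row_mxKr !row_mxKl row_mxKr.
  by split; [exact/WV1/W12|exact: WV2|exact: WV2].
move=> w W2w; have W1w := W12 _ W2w.
have a12 : F2 (a2 w) = F1 (a1 w).
  by have := svalP (s w); rewrite (E1 _ W1w) (E2 _ W2w).
rewrite (@fib_addE _ _ (s w) (F1 (a1 w)) (tanv _ F1 (a1 w) (b1 w))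
  (tanv _ F2 (a2 w) (b2 w))).
- rewrite (tanvD _ _ P1 P2 (WV1 _ W1w) (WV2 _ W2w) erefl a12) -tvecE //.
  by rewrite /add_plot row_mxKr !row_mxKl row_mxKr -mulA mulV mule.
- by rewrite E1.
- by rewrite E2 // -tvecE.
Qed.

Lemma hector_fib_scale m (W : set (E m)) r p :
  R_plots W r -> H m W p -> H m W (fun w => fib_scale (r w, p w)).
Proof.
move=> [oW sr] Hp.
apply: (hector_ind dH Hp) => W' n V F a b oW' W'W PV sa sb WV pE.
have sr' := smooth_sub W'W sr.
(* [R_plots] records [r] as a row of length one, so the scalar is its coordinate 0. *)
have HZ := hector_tvec dP colim oW' PV sa (smooth_scale oW' 0 sr' sb) WV.
apply: (plot_congr dH HZ) => w W'w.
rewrite /fib_scale pE //= mxE /tvec; congr existT.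
exact: linZ (tanv_lin dP colim PV (WV _ W'w) erefl).
Qed.

Lemma hector_zero_sec m (W : set (E m)) p :
  P W p -> H m W (fun w => zero_sec T (p w)).
Proof.
move=> Pp; have oW := plot_open dP Pp.
apply: (plot_congr dH (hector_tvec dP colim oW Pp
  (smooth_lin W (@lin_id m)) (smooth_cst W (0 : E m)) (fun w Ww => Ww))) => w Ww.
by rewrite /tvec /zero_sec (lin0 (tanv_lin dP colim Pp Ww erefl)).
Qed.

Lemma is_dvs_hector : is_dvs P H.
Proof.
split.
- exact: hector_proj.
- by move=> m W s [H1 H2]; exact: hector_fib_add.
- move=> m W p [Rr Hp].
  apply: (plot_congr dH (hector_fib_scale Rr Hp)) => w _.
  by rewrite /= -surjective_pairing.
- exact: hector_zero_sec.
Qed.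

(** Hector's diffeology is itself one of the diffeologies intersected in [dvs_plots], and all of
    them contain it. *)
Lemma dvs_plots_hector : dvs_plots P iota = H.
Proof.
apply: functional_extensionality_dep => m; apply/funext => W; apply/funext => p.
apply/propext; split.
  by apply => //; exact: is_dvs_hector.
by move=> Hp Q dQ HQ _; exact: HQ.
Qed.

(** * Left translations and the trivialization of the bundle *)

Lemma left_translation g x z : mul g x = z -> exists L : T x -> T z, lin L /\
  forall n (V : set (E n)) F u v, P V F -> V u -> F u = x ->
    L (tanv x F u v) = tanv z (fun y => mul g (F y)) u v.
Proof.
move=> gx; have gP n (U : set (E n)) p : pointed P x U p ->
    pointed P z U (fun y => mul g (p y)).
  by move=> [Pp cU U0 p0]; split; rewrite ?p0 //; exact: plot_mull.
have [_ univ] := colim x.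
have [|L [lL LE _]] := univ (T z) (fun n U p => iota z U (fun y => mul g (p y))).
  split=> [n U p /gP pU|n m U V p q f /gP pU /gP qV [sf UV f0 qf] v].
    exact: iota_lin.
  by apply: (iota_natural colim) => //; split=> // y /qf ->.
exists L; split=> // n V F u v PV Vu Fu.
have pF := germ_pointed dP PV Vu Fu.
rewrite /tanv LE //; apply/esym.
by apply: (tanv_iota dP colim _ (gP _ _ _ pF) (plot_mull g PV) Vu); rewrite // Fu.
Qed.

(** The differentials of translation by [inv x] and by [x]; the translating element is read off from
    the equation supplied. *)
Definition to_e x : T x -> T e := sval (cid (left_translation (mulV x))).
Definition from_e x : T e -> T x := sval (cid (left_translation (mule x))).

Lemma to_e_lin x : lin (@to_e x).
Proof. by rewrite /to_e; case: cid => L []. Qed.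

Lemma from_e_lin x : lin (@from_e x).
Proof. by rewrite /from_e; case: cid => L []. Qed.

Lemma to_e_tanv x n (V : set (E n)) F u v : P V F -> V u -> F u = x ->
  to_e (tanv x F u v) = tanv e (fun y => mul (inv x) (F y)) u v.
Proof. by rewrite /to_e; case: cid => L [_ LE] /= PV Vu Fu; exact: LE PV Vu Fu. Qed.

Lemma from_e_tanv x n (V : set (E n)) F u v : P V F -> V u -> F u = e ->
  from_e x (tanv e F u v) = tanv x (fun y => mul x (F y)) u v.
Proof. by rewrite /from_e; case: cid => L [_ LE] /= PV Vu Fu; exact: LE PV Vu Fu. Qed.

Lemma to_eK x : cancel (@to_e x) (@from_e x).
Proof.
move=> t; have [n [V [F [u [v [PV Vu Fu ->]]]]]] := tanv_surj t.
rewrite (to_e_tanv _ PV) // (from_e_tanv _ _ (plot_mull _ PV)) //.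
  by congr tanv; apply/funext => y; rewrite mulA mulVr mul1.
by rewrite Fu mulV.
Qed.

Lemma from_eK x : cancel (@from_e x) (@to_e x).
Proof.
move=> t; have [n [V [F [u [v [PV Vu Fu ->]]]]]] := tanv_surj t.
rewrite (from_e_tanv _ _ PV) // (to_e_tanv _ (plot_mull _ PV)) //.
  by congr tanv; apply/funext => y; rewrite mulA mulV mul1.
by rewrite Fu mule.
Qed.

(** The translating element [inv (F (a w))] varies with [w], so it becomes a separate variable of
    the plot [F']; the direction [(0, b w)] leaves that variable fixed, so at each [w] only the
    translate of [F] by a constant is differentiated. *)
Lemma hector_to_e m (W : set (E m)) p : H m W p ->
  H m W (fun w => existT (fun x => T x) e (to_e (projT2 (p w)))).
Proof.
move=> Hp; apply: (hector_ind dH Hp) => W' n V F a b oW' W'W PV sa sb WV pE.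
have oV := plot_open dP PV.
pose D := [set z : E (n + n) | V (lsubmx z)] `&` [set z : E (n + n) | V (rsubmx z)].
have oD : open D by apply: openI; apply: lin_preimage_open => //;
  [exact: lin_lsubmx|exact: lin_rsubmx].
pose F' (z : E (n + n)) := mul (inv (F (lsubmx z))) (F (rsubmx z)).
have PD : P D F'.
  apply: plot_mul; first apply: plot_inv.
    by apply: (plot_lin dP oD PV (@lin_lsubmx n n)) => z [].
  by apply: (plot_lin dP oD PV (@lin_rsubmx n n)) => z [].
have HD := @hector_tvec _ _ _ iota dP colim m W' _ _ _
  (fun w => row_mx (a w) (a w)) (fun w => row_mx 0 (b w)) oW' PD.
apply: (plot_congr dH (HD _ _ _)).
- exact: smooth_row_mx.
- by apply: smooth_row_mx => //; exact: smooth_cst.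
- by move=> w W'w; rewrite /D /= row_mxKr row_mxKl; split; exact: WV.
move=> w W'w; have Vw := WV _ W'w.
rewrite pE //= (to_e_tanv _ PV) // (@tvecE _ _ _ iota e); last first.
  by rewrite /F' row_mxKl row_mxKr mulV.
congr existT.
have := @tanv_affine e _ _ V D (fun y => mul (inv (F (a w))) (F y)) F'
  (fun y => row_mx 0 y) (row_mx (a w) 0) (a w) (b w) (plot_mull _ PV) PD
  (@lin_row_mxr n n).
rewrite add_row_mx addr0 add0r; apply=> //.
- by move=> y Vy; rewrite add_row_mx addr0 add0r /D /= row_mxKl row_mxKr.
- by move=> y Vy; rewrite add_row_mx addr0 add0r /F' row_mxKl row_mxKr.
Qed.

Lemma hector_from_e m (W : set (E m)) q t :
  P W q -> H m W (fun w => existT (fun x => T x) e (t w)) ->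
  H m W (fun w => existT (fun x => T x) (q w) (from_e (q w) (t w))).
Proof.
move=> Pq Ht; apply: (hector_ind dH Ht) => W' n V F a b oW' W'W PV sa sb WV tE.
have oV := plot_open dP PV; have oW := plot_open dP Pq.
pose D := [set z : E (m + n) | W (lsubmx z)] `&` [set z : E (m + n) | V (rsubmx z)].
have oD : open D by apply: openI; apply: lin_preimage_open => //;
  [exact: lin_lsubmx|exact: lin_rsubmx].
pose F' (z : E (m + n)) := mul (q (lsubmx z)) (F (rsubmx z)).
have PD : P D F'.
  apply: plot_mul.
    by apply: (plot_lin dP oD Pq (@lin_lsubmx m n)) => z [].
  by apply: (plot_lin dP oD PV (@lin_rsubmx m n)) => z [].
have HD := @hector_tvec _ _ _ iota dP colim m W' _ _ _
  (fun w => row_mx w (a w)) (fun w => row_mx 0 (b w)) oW' PD.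
apply: (plot_congr dH (HD _ _ _)).
- by apply: smooth_row_mx => //; exact/smooth_lin/lin_id.
- by apply: smooth_row_mx => //; exact: smooth_cst.
- by move=> w W'w; rewrite /D /= row_mxKr row_mxKl; split; [exact: W'W|exact: WV].
move=> w W'w; have Vw := WV _ W'w; have Ww := W'W _ W'w.
have Fe : F (a w) = e by have /(congr1 (@projT1 _ _)) := tE _ W'w.
have -> : t w = tanv e F (a w) (b w).
  have := tE _ W'w; rewrite (tvecE P iota _ Fe); exact: existT_inj.
rewrite (from_e_tanv _ _ PV) // (@tvecE _ _ _ iota (q w)); last first.
  by rewrite /F' row_mxKl row_mxKr Fe mule.
congr existT.
have := @tanv_affine (q w) _ _ V D (fun y => mul (q w) (F y)) F'
  (fun y => row_mx 0 y) (row_mx w 0) (a w) (b w) (plot_mull _ PV) PD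
  (@lin_row_mxr m n).
rewrite add_row_mx addr0 add0r; apply=> //.
- by move=> y Vy; rewrite add_row_mx addr0 add0r /D /= row_mxKl row_mxKr.
- by move=> y Vy; rewrite add_row_mx addr0 add0r /F' row_mxKl row_mxKr.
- by rewrite Fe mule.
Qed.

Lemma hector_trivialization : dvs_iso H (prodc_plots P (fibre_plots e H)).
Proof.
exists to_e, from_e; split.
- by move=> x; split; [exact: to_e_lin|exact: from_e_lin].
- exact: to_eK.
- exact: from_eK.
- by move=> m W p Hp; split; [exact: hector_proj|exact: hector_to_e].
- by move=> m W p [Pp Hp]; exact: hector_from_e.
Qed.

End Group.

(** * Comparison of the bundles *)

Lemma dvs_iso_refl (X : Type) (F : X -> lmodType RR) (Q : plots {x : X & F x}) :
  is_diffeology Q -> dvs_iso Q Q.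
Proof.
move=> dQ; exists (fun x t => t), (fun x t => t); split=> //;
(* [tot] rebuilds each dependent pair, so it fixes points only after a case analysis. *)
by move=> m W p Qp; apply: (plot_congr dQ Qp) => w _ /=; case: (p w).
Qed.

Theorem theorem4p15 (G : Type) (P : plots G) (mul : G -> G -> G) (inv : G -> G) (e : G)
  (T : G -> lmodType RR)
  (iota : forall x n, set (E n) -> (E n -> G) -> E n -> T x) :
  is_diffeological_group P mul inv e ->
  (forall x, is_tangent_colimit P x (iota x)) ->
  [/\ is_dvs P (hector_plots P iota),
      dvs_iso (hector_plots P iota)
              (prodc_plots P (fibre_plots e (hector_plots P iota))),
      dvs_iso (hector_plots P iota) (dvs_plots P iota),
      dvs_iso (hector_plots P iota)
              (prodc_plots P (fibre_plots e (dvs_plots P iota)))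
    & forall (g : G) n U p,
        fibre_plots g (hector_plots P iota) n U p <-> fibre_plots g (dvs_plots P iota) n U p].
Proof.
(* With the two diffeologies equal, both product statements become the same trivialization and the
   fibrewise claim becomes reflexive. *)
move=> dG colim; rewrite (dvs_plots_hector dG colim).
have trivH := hector_trivialization dG colim.
split=> //; first exact: is_dvs_hector dG colim.
by apply: dvs_iso_refl; apply: is_diffeology_hector => //; case: dG.
Qed.
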